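(* Let $V$ be a countable subset of $\mathbb{R}_+$ containing $0$, satisfying the four-values condition, and such that $0$ is an accumulation point of $V$. Then for every $V$-sub-scattered subspace of the Urysohn space $\mathbb{U}_V$, the complementary subspace is isometric to $\mathbb{U}_V$.
   Context: $\mathbb{R}_+$ is the set of non-negative reals. For $u_1,u_2,u_1',u_2'\in V$ let $\phi(u_1,u_2,u_1',u_2'):=[\max\{|u_1-u_2|,|u_1'-u_2'|\},\ \min\{u_1+u_2,u_1'+u_2'\}]$ and say that $\rho_V(u_1,u_2,u_1',u_2')$ holds if $\phi(u_1,u_2,u_1',u_2')\cap V\neq\emptyset$. $V$ satisfies the four-values condition if for all $u_1,u_2,u_1',u_2'\in V$, $\rho_V(u_1,u_2,u_1',u_2')$ implies $\rho_V(u_1,u_1',u_2,u_2')$. The spectrum of a metric space $(M;d)$ is $\{d(x,y): x,y\in M\}$. The age of a metric space is the class of all finite metric spaces that embed isometrically into it. A metric space is homogeneous if every isometry between two of its finite subspaces extends to an isometry of the space onto itself. $\mathcal{M}_{V,<\omega}$ is the class of finite metric spaces whose spectrum is included in $V$. When $V$ is countable and satisfies the four-values condition there is a countable homogeneous metric space, unique up to isometry, whose age is $\mathcal{M}_{V,<\omega}$; it is denoted $\mathbb{U}_V$ and called the Urysohn space with spectrum $V$. Let $\mathbb{M}=(M,d)$ be a metric space with spectrum included in $V$. An element $a\in M$ is a $V$-sub-isolated point of $\mathbb{M}$ if for every $\epsilon>0$ there is a countable metric space $\mathbb{X}$ with at least two points, with spectrum included in $V$ and diameter at most $\epsilon$,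 such that $a$ does not belong to the union of the isometric copies of $\mathbb{X}$ in $\mathbb{M}$. Let $\mathbb{M}'$ be the subspace of $\mathbb{M}$ consisting of the elements which are not $V$-sub-isolated in $\mathbb{M}$. Define for each ordinal $\alpha$: $\mathbb{M}^{(0)}:=\mathbb{M}$; $\mathbb{M}^{(\beta+1)}:=(\mathbb{M}^{(\beta)})'$; and $\mathbb{M}^{(\alpha)}:=\bigcap_{\beta<\alpha}\mathbb{M}^{(\beta)}$ if $\alpha$ is a limit ordinal. $\mathbb{M}$ is $V$-sub-scattered if $\mathbb{M}^{(\alpha)}$ is empty for some ordinal $\alpha$. *)

(* Defs.v *)
From mathcomp Require Import all_boot all_order all_algebra.
From mathcomp Require Import all_classical all_reals all_analysis.
From mathcomp Require Export wochoice.

Set Implicit Arguments.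
Unset Strict Implicit.
Unset Printing Implicit Defensive.

Import Order.TTheory GRing.Theory Num.Theory.
Import numFieldNormedType.Exports.

Local Open Scope classical_set_scope.
Local Open Scope ring_scope.

Section FourValues.
Variables (R : realType) (V : set R).

Definition phi (u1 u2 u1' u2' : R) : set R :=
  `[Num.max `|u1 - u2| `|u1' - u2'|, Num.min (u1 + u2) (u1' + u2')].

Definition rho (u1 u2 u1' u2' : R) : Prop :=
  (phi u1 u2 u1' u2' `&` V) !=set0.

Definition four_values : Prop :=
  forall u1 u2 u1' u2' : R, V u1 -> V u2 -> V u1' -> V u2' ->
    rho u1 u2 u1' u2' -> rho u1 u1' u2 u2'.

End FourValues.

(* Subspaces of a metric space are represented by sets of points, and a map
   between subspaces by a total map of which only the values on the source
   matter. *)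
Section Isometries.
Variable R : realType.

Definition spectrum (S : metricType R) : set R :=
  [set r | exists x y : S, r = mdist x y].

Definition diameter (S : metricType R) : \bar R :=
  ereal_sup [set r%:E | r in spectrum S].

Definition isometry_onto (S T : metricType R) (A : set S) (B : set T)
    (f : S -> T) : Prop :=
  (forall x y, A x -> A y -> mdist (f x) (f y) = mdist x y) /\ f @` A = B.

Definition isometric (S T : metricType R) (A : set S) (B : set T) : Prop :=
  exists f : S -> T, isometry_onto A B f.

Definition homogeneous (T : metricType R) : Prop :=
  forall (A B : set T) (f : T -> T), finite_set A -> finite_set B ->
    isometry_onto A B f ->
    exists g : T -> T, isometry_onto setT setT g /\ forall x, A x -> g x = f x.

Definition copies (X T : metricType R) (M : set T) : set (set T) :=
  [set C | C `<=` M /\ isometric [set: X] C].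

Definition in_age (T F : metricType R) : Prop :=
  finite_set [set: F] /\ exists C, copies F [set: T] C.

End Isometries.

Section Urysohn.
Variables (R : realType) (V : set R).

Definition finite_metric_spectrum_in (F : metricType R) : Prop :=
  finite_set [set: F] /\ spectrum F `<=` V.

Definition is_urysohn (U : metricType R) : Prop :=
  [/\ countable [set: U], homogeneous U &
      forall F : metricType R, in_age U F <-> finite_metric_spectrum_in F].

End Urysohn.

Section SubScattered.
Variables (R : realType) (V : set R) (T : metricType R).
Implicit Type M : set T.

Definition sub_isolated M (a : T) : Prop :=
  M a /\
  forall eps : R, 0 < eps ->
    exists X : metricType R,
      [/\ countable [set: X], exists x y : X, x <> y, spectrum X `<=` V,
          (diameter X <= eps%:E)%E & ~ (\bigcup_(C in copies X M) C) a].

Definition derived M : set T := M `\` [set a | sub_isolated M a].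

Section Derivatives.
Variables (W : eqType) (le : rel W).

Definition below (b a : W) : Prop := le b a /\ b <> a.

Definition is_zero (a : W) : Prop := forall b, ~ below b a.

Definition is_succ (b a : W) : Prop :=
  below b a /\ forall c, below c a -> le c b.

Definition is_limit (a : W) : Prop :=
  ~ is_zero a /\ forall b, ~ is_succ b a.

(* When [W] is well-ordered by [le], each [a : W] stands for the ordinal that is
   the order type of its strict initial segment, and these equations determine
   [D] uniquely: [D a] is the derivative of [M] of that order. *)
Definition derivatives M (D : W -> set T) : Prop :=
  [/\ forall a, is_zero a -> D a = M,
      forall b a, is_succ b a -> D a = derived (D b) &
      forall a, is_limit a -> D a = \bigcap_(b in [set b | below b a]) D b].

End Derivatives.

Definition sub_scattered M : Prop :=
  exists (W : eqType) (le : rel W) (D : W -> set T) (a : W),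
    [/\ well_order le, derivatives le M D & D a = set0].

End SubScattered.

(* Main.v *)
From HB Require Import structures.
Require Import Defs.
From mathcomp Require Import all_boot all_order all_algebra.
From mathcomp Require Import all_classical all_reals all_analysis.
From mathcomp Require Import lra.

Set Implicit Arguments.
Unset Strict Implicit.
Unset Printing Implicit Defensive.

Import Order.TTheory GRing.Theory Num.Theory.
Import numFieldNormedType.Exports.

Local Open Scope classical_set_scope.
Local Open Scope ring_scope.

(** The Urysohn space has the one-point extension property: every one-point
    metric extension with distances in [V] of a finite subspace is realized in
    the space ([urysohn_saturated]); and two countable subspaces with this
    property are isometric by back and forth ([saturated_isometric]). It
    therefore suffices that the complement of a sub-scattered set [A] has it
    ([saturated_setC_sub_scattered]).

    Take a one-point extension of a finite set disjoint from [A], all of whose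
    new distances are positive, and let [O] be the set of points of the whole
    space that realize it. Let [X] be a countable space with spectrum in [V]
    and diameter at most all the new distances. Giving all points of [X] the
    same prescribed distances to the finite set yields a metric space, so the
    extension property produces, through every point of [O], a copy of [X]
    contained in [O] ([copy_in_realizations]). Hence no point of [O] is
    sub-isolated in a set that contains [O]. If [O] were contained in [A],
    transfinite induction would put [O] inside every derivative of [A]
    ([sub_scattered_subset0]); but some derivative of [A] is empty while [O] is
    not. So some point of [O] lies outside [A]. *)

(** * Back and forth between metric spaces *)

Section PartialIsometries.
Variables (R : realType) (S T : metricType R).
Implicit Types (p : seq (S * T)) (A : set S) (B C : set T).

(** A finite partial isometry is encoded by its graph; that the graph is
    single-valued and injective follows from distances being preserved. *)
Definition partial_isometry A B p : Prop :=
  (forall z, z \in p -> A z.1 /\ B z.2) /\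
  forall z w, z \in p -> w \in p -> mdist z.2 w.2 = mdist z.1 w.1.

Lemma partial_isometry_cons A B p x y :
  partial_isometry A B p -> A x -> B y ->
  (forall z, z \in p -> mdist y z.2 = mdist x z.1) ->
  partial_isometry A B ((x, y) :: p).
Proof.
move=> [pAB pd] Ax By yd; split=> [z|z w].
  by rewrite inE => /orP[/eqP->|/pAB].
rewrite !inE => /orP[/eqP->|zp] /orP[/eqP->|wp] /=.
- by rewrite !mdistxx.
- exact: yd.
- by rewrite metric_sym yd// metric_sym.
- exact: pd.
Qed.

(** Having two sets of requirements, points of [A] to be mapped and points of
    [C] to be hit, covers both uses: [C] is the whole target when an isometry
    onto is wanted, and empty when [A] only has to be embedded. Enumerating the
    requirements by [nat], one meets them in turn along an increasing sequence
    of partial isometries starting from [p0], whose union is the graph of the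
    desired map. The point [t0] serves only as a default value outside [A]. *)
Lemma back_and_forth A B C p0 (t0 : T) :
  countable A -> countable C -> partial_isometry A B p0 ->
  (forall p x, partial_isometry A B p -> A x ->
    exists y, partial_isometry A B ((x, y) :: p)) ->
  (forall p y, partial_isometry A B p -> C y ->
    exists x, partial_isometry A B ((x, y) :: p)) ->
  exists f : S -> T,
    [/\ forall x y, A x -> A y -> mdist (f x) (f y) = mdist x y,
        f @` A `<=` B, C `<=` f @` A & forall z, z \in p0 -> f z.1 = z.2].
Proof.
move=> /countable_injP[g ginj] /countable_injP[h hinj] p0i forth back.
pose meets n p := (forall x, A x -> g x = n -> exists y, (x, y) \in p) /\
                  (forall y, C y -> h y = n -> exists x, (x, y) \in p).
have step (np : nat * seq (S * T)) : exists p', partial_isometry A B np.2 ->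
    [/\ partial_isometry A B p', {subset np.2 <= p'} & meets np.1 p'].
  case: np => n p /=.
  have [pi|npi] := pselect (partial_isometry A B p); last by exists p.
  have [q [qi pq qA]] : exists q, [/\ partial_isometry A B q, {subset p <= q} &
      forall x, A x -> g x = n -> exists y, (x, y) \in q].
    have [[x [Ax gx]]|nx] := pselect (exists x, A x /\ g x = n).
      have [y xyi] := forth p x pi Ax.
      exists ((x, y) :: p); split=> // [z zp|x' Ax' gx'].
        by rewrite inE zp orbT.
      have -> : x' = x by apply: ginj; rewrite ?gx' ?gx//; exact: mem_set.
      by exists y; rewrite inE eqxx.
    by exists p; split=> // x Ax gx; case: nx; exists x.
  have [[y [Cy hy]]|ny] := pselect (exists y, C y /\ h y = n).
    have [x xyi] := back q y qi Cy.
    exists ((x, y) :: q) => _; split=> // [z /pq zq|].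
      by rewrite inE zq orbT.
    split=> [x' Ax' gx'|y' Cy' hy'].
      by have [y' ?] := qA x' Ax' gx'; exists y'; rewrite inE; apply/orP; right.
    have -> : y' = y by apply: hinj; rewrite ?hy' ?hy//; exact: mem_set.
    by exists x; rewrite inE eqxx.
  by exists q => _; split=> //; split=> // y Cy hy; case: ny; exists y.
have [F FP] := choice step.
pose P := nat_rect (fun=> seq (S * T)) p0 (fun n p => F (n, p)).
have Pi n : partial_isometry A B (P n).
  by elim: n => [|n IH] //=; have [] := FP (n, P n) IH.
have PS n : {subset P n <= P n.+1} by have [] := FP (n, P n) (Pi n).
have Pm n : meets n (P n.+1) by have [] := FP (n, P n) (Pi n).
have Pmono m n : (m <= n)%N -> {subset P m <= P n}.
  by move=> /subnK <-; elim: (n - m)%N => [|k IH] //= z /IH /PS.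
have Pd m n z w : z \in P m -> w \in P n -> mdist z.2 w.2 = mdist z.1 w.1.
  move=> /(Pmono _ _ (leq_maxl m n)) zP /(Pmono _ _ (leq_maxr m n)) wP.
  by have [_ ->] := Pi (maxn m n).
have fex x : exists y, A x -> exists n, (x, y) \in P n.
  have [Ax|] := pselect (A x); last by exists t0.
  by have [y xy] := (Pm (g x)).1 x Ax erefl; exists y => _; exists (g x).+1.
have [f fP] := choice fex.
have fE n z : z \in P n -> f z.1 = z.2.
  move=> zP; have [Az1 _] := (Pi n).1 z zP.
  have [m fm] := fP _ Az1; apply: mdist_positivity.
  by rewrite (Pd _ _ (z.1, f z.1) z fm zP) mdistxx.
exists f; split.
- by move=> x y /fP[m xm] /fP[n yn]; rewrite (Pd _ _ _ _ xm yn).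
- by move=> _ [x Ax <-]; have [n xn] := fP x Ax; have [] := (Pi n).1 _ xn.
- move=> y Cy; have [x xy] := (Pm (h y)).2 y Cy erefl.
  by exists x; [have [] := (Pi _).1 _ xy | exact: fE xy].
- by move=> z zp; apply: (fE 0).
Qed.

End PartialIsometries.

(** * One-point extensions *)

Section Saturation.
Variables (R : realType) (V : set R) (U : metricType R).
Implicit Types (c : seq (U * R)) (B : set U).

(** A list of pairs (point, distance) is the type of a virtual new point over
    finitely many points; these inequalities say that adding the new point
    gives a (pseudo)metric space with spectrum in [V]. Using a list rather than
    a function on a finite set lets types be concatenated, and a point listed
    twice is harmless because the first inequality then equates its two
    distances. *)
Definition katetov c : Prop :=
  (forall z, z \in c -> V z.2) /\
  forall z w, z \in c -> w \in c ->
    z.2 <= w.2 + mdist z.1 w.1 /\ mdist z.1 w.1 <= z.2 + w.2.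

Definition realizations c : set U :=
  [set u | forall z, z \in c -> mdist u z.1 = z.2].

Lemma katetov_zero c z : katetov c -> z \in c -> z.2 = 0 -> realizations c z.1.
Proof.
move=> ck zc z0 w wc; have := ck.2 z w zc wc; have := ck.2 w z wc zc.
by rewrite z0 (metric_sym w.1); lra.
Qed.

(** This is the one-point extension property of the subspace [B]: being
    realizable in principle suffices for being realized in [B]. Since realizing
    a type over the empty list only asks for a point, it also makes [B]
    nonempty. *)
Definition saturated B : Prop :=
  forall c, katetov c -> (forall z, z \in c -> B z.1) ->
    (realizations c `&` B) !=set0.

(** The type that the image of [x] must realize for [p] to extend to [x]. *)
Definition transported (S : metricType R) (x : S) (p : seq (S * U)) :=
  [seq (z.2, mdist x z.1) | z <- p].

Lemma katetov_transported (S : metricType R) (x : S) A B p :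
  spectrum S `<=` V -> partial_isometry A B p -> katetov (transported x p).
Proof.
move=> SV [_ pd]; split=> [_ /mapP[z zp ->]|].
  by apply: SV; exists x, z.1.
move=> _ _ /mapP[z zp ->] /mapP[w wp ->] /=; rewrite pd//; split.
  by rewrite [mdist z.1 w.1]metric_sym metric_triangle.
by rewrite (le_trans (metric_triangle _ x _))// (metric_sym z.1).
Qed.

Lemma saturated_isometric B B' : spectrum U `<=` V -> countable [set: U] ->
  saturated B -> saturated B' -> isometric B B'.
Proof.
move=> UV Uc sB sB'.
have [t0 _] : (realizations [::] `&` B) !=set0 by apply: sB => //; split.
have cU X : countable X := sub_countable (subset_card_le (@subsetT _ X)) Uc.
have [|||f [fd fB fB' _]] :=
  @back_and_forth _ U U B B' B' [::] t0 (cU _) (cU _).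
- by split.
- move=> p x pi Bx; have [||y [yr B'y]] := sB' (transported x p).
  + exact: katetov_transported pi.
  + by move=> _ /mapP[z zp ->]; have [] := pi.1 z zp.
  exists y; apply: partial_isometry_cons => // z zp.
  by apply: (yr (z.2, _)); apply/mapP; exists z.
- move=> p y pi B'y.
  pose swap (z : U * U) := (z.2, z.1).
  have [||x [xr Bx]] := sB (transported y (map swap p)).
  + apply: (@katetov_transported _ _ B' B) => //.
    split=> [_ /mapP[z zp ->]|_ v /mapP[z zp ->]].
      by have [] := pi.1 z zp.
    by move=> /mapP[w wp ->] /=; rewrite pi.2.
  + by move=> _ /mapP[_ /mapP[z zp ->] ->]; have [] := pi.1 z zp.
  exists x; apply: partial_isometry_cons => // z zp; apply/esym.
  apply: (xr (z.1, _)); apply/mapP; exists (swap z) => //.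
  by apply/mapP; exists z.
by exists f; split=> //; apply/seteqP.
Qed.

(** Once the points of [X] are all placed at the prescribed distances of [c]
    from the points of [c], only two families of triangle inequalities are not
    already known: [|r - r| <= d(x, y)], which is trivial, and
    [d(x, y) <= r + r], which is the bound assumed on [X]. So every partial
    isometry of [X] into the realizations of [c] extends by one point, and a
    copy of [X] is built there starting from the single pair [(x0, a)]. *)
Lemma copy_in_realizations c a (X : metricType R) (x0 : X) :
  saturated [set: U] -> katetov c -> realizations c a ->
  countable [set: X] -> spectrum X `<=` V ->
  (forall z (x y : X), z \in c -> mdist x y <= 2 * z.2) ->
  exists2 C, copies X (realizations c) C & C a.
Proof.
move=> sU ck ca Xc XV Xd.
have [||p x pi _||f [fd fB _ fa]] :=
  @back_and_forth _ X U [set: X] (realizations c) set0 [:: (x0, a)] a Xc.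
- exact: countable0.
- split=> [z|z w]; rewrite !inE => /eqP->//.
  by move=> /eqP->; rewrite !mdistxx.
- have [||y [yr _]] := sU (c ++ transported x p) => //.
    have tk := katetov_transported x XV pi.
    have cross z w : z \in c -> w \in transported x p ->
      mdist w.1 z.1 = z.2 /\ 0 <= w.2 <= 2 * z.2.
      move=> zc /mapP[w' wp ->] /=.
      by rewrite (pi.1 w' wp).2// mdist_ge0 Xd.
    split=> [z|z w]; rewrite !mem_cat; first by move=> /orP[/ck.1|/tk.1].
    move=> /orP[zc|zt] /orP[wc|wt].
    + exact: ck.2.
    + have [e /andP[? ?]] := cross z w zc wt.
      by rewrite metric_sym e; split; lra.
    + have [e /andP[? ?]] := cross w z wc zt.
      by rewrite e; split; lra.
    + exact: tk.2.
  exists y; apply: partial_isometry_cons => //.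
    by move=> z zc; apply: yr; rewrite mem_cat zc.
  move=> z zp; apply: (yr (z.2, _)); rewrite mem_cat; apply/orP; right.
  by apply/mapP; exists z.
- by [].
exists (range f); last by exists x0 => //; rewrite (fa (x0, a)) ?inE.
by split=> //; exists f; split.
Qed.

(** All spaces [X] of diameter at most the least distance prescribed by [c] (of
    any diameter, if [c] is empty) have a copy through [a], which refutes
    sub-isolation in any [M] large enough to contain these copies. *)
Lemma realizations_not_sub_isolated c a M :
  saturated [set: U] -> katetov c -> (forall z, z \in c -> 0 < z.2) ->
  realizations c `<=` M -> realizations c a -> ~ sub_isolated V M a.
Proof.
move=> sU ck cpos cM ca [_ iso].
have [eps eps0 epsc] : exists2 eps : R, 0 < eps &
    forall z, z \in c -> eps <= z.2.
  elim: c cpos {ck cM ca} => [|z c IH] cpos; first by exists 1.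
  have [w wc|e e0 ec] := IH; first by apply: cpos; rewrite inE wc orbT.
  exists (Num.min z.2 e); first by rewrite lt_min e0 cpos// inE eqxx.
  by move=> w; rewrite inE ge_min => /orP[/eqP->|/ec ->]; rewrite ?lexx ?orbT.
have [X [Xc [x0 _] XV Xd]] := iso eps eps0; apply.
have [z x y zc|C [CO Ci] Ca] := copy_in_realizations x0 sU ck ca Xc XV.
  have : ((mdist x y)%:E <= diameter X)%E.
    by apply: ereal_sup_ubound; exists (mdist x y) => //; exists x, y.
  move=> /le_trans/(_ Xd); rewrite lee_fin => xy.
  by have := epsc z zc; lra.
by exists C => //; split=> //; apply: subset_trans cM.
Qed.

End Saturation.

(** * Complements of sub-scattered sets *)

Section SubScatteredSets.
Variables (R : realType) (V : set R) (U : metricType R).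

Lemma well_order_ind (W : eqType) (le : rel W) (P : W -> Prop) :
  well_order le -> (forall a, (forall b, below le b a -> P b) -> P a) ->
  forall a, P a.
Proof.
move=> wo IH a; apply: contrapT => nPa.
have anti : {in predT &, antisymmetric le}.
  by apply: wo_chain_antisymmetric => A _; exact: wo.
have [|m [[/asboolP mP mmin] _]] := wo [pred x | `[< ~ P x >]].
  by exists a; exact/asboolP.
apply: mP; apply: IH => b [bm neq]; apply: contrapT => nPb; apply: neq.
by apply: anti => //; rewrite bm mmin//; exact/asboolP.
Qed.

(** A subset of [A] none of whose points can be sub-isolated in a larger set is
    never touched by the derivation, so it lies in every derivative of [A]. *)
Lemma sub_scattered_subset0 (A O : set U) : sub_scattered V A -> O `<=` A ->
  (forall M a, O `<=` M -> O a -> ~ sub_isolated V M a) -> O = set0.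
Proof.
move=> [W [le [D [a [wo [D0 DS Dlim] Da]]]]] OA Onot.
rewrite -subset0 -Da; move: a {Da}; apply: (well_order_ind wo) => a IH.
have [/D0 ->//|nz] := pselect (is_zero le a).
have [[b ba]|nsucc] := pselect (exists b, is_succ le b a).
  rewrite (DS _ _ ba) => u Ou; split; first exact: IH ba.1 u Ou.
  exact: Onot (IH b ba.1) Ou.
rewrite Dlim; first by move=> u Ou b /IH; exact.
by split=> // b ba; apply: nsucc; exists b.
Qed.

(** If no point outside [A] realized the type [c], the realizations of [c] would
    form a subset of [A] that survives every derivation, hence be empty, whereas
    the whole space realizes [c]. *)
Lemma saturated_setC_sub_scattered (A : set U) :
  saturated V [set: U] -> sub_scattered V A -> saturated V (~` A).
Proof.
move=> sU sA c ck cA.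
(* A type with a zero distance is realized by the point at distance zero. *)
have [[z [zc z0]]|nz] := pselect (exists z, z \in c /\ z.2 = 0).
  by exists z.1; split; [exact: katetov_zero ck zc z0 | exact: cA].
have cpos z : z \in c -> 0 < z.2.
  move=> zc; rewrite lt_neqAle; apply/andP; split.
    by apply/eqP => z0; apply: nz; exists z.
  by have := ck.2 z z zc zc; rewrite mdistxx; lra.
apply: contrapT => /set0P/negP/negPn/eqP cA0.
have cO : realizations c = set0.
  apply: (sub_scattered_subset0 sA) => [|M a cM ca].
    by rewrite -[A]setCK -disjoints_subset.
  exact: realizations_not_sub_isolated cM ca.
have [u [uc _]] : (realizations c `&` [set: U]) !=set0 by exact: sU.
by rewrite cO in uc.
Qed.

End SubScatteredSets.

(** * The Urysohn space is saturated *)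

Section MetricOfDistance.
Variables (R : realType) (T : choiceType) (d : T -> T -> R).
Hypotheses (d0 : forall x, d x x = 0) (dpos : forall x y, d x y = 0 -> x = y)
  (dsym : forall x y, d x y = d y x)
  (dtri : forall y x z, d x z <= d x y + d y z).

(** The axioms of the distance are arguments of this copy of [T], so that the
    metric structure attached to it can be inferred from its type. *)
Definition space_of & (forall x, d x x = 0) & (forall x y, d x y = 0 -> x = y)
  & (forall x y, d x y = d y x) & (forall y x z, d x z <= d x y + d y z) :
  Type := T.

HB.instance Definition _ := Choice.on (space_of d0 dpos dsym dtri).
HB.instance Definition _ :=
  isMetric.Build R (space_of d0 dpos dsym dtri) d0 dpos dsym dtri.

Lemma metric_of_distance : exists (M : metricType R) (h : T -> M),
  range h = setT /\ forall x y, mdist (h x) (h y) = d x y.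
Proof.
by exists (space_of d0 dpos dsym dtri), id; split=> //; rewrite image_id.
Qed.

End MetricOfDistance.

Section UrysohnSpaces.
Variables (R : realType) (V : set R) (U : metricType R).
Hypothesis U_urysohn : is_urysohn V U.

Lemma finite_distance_embeds (T : finType) (d : T -> T -> R) :
  (forall x, d x x = 0) -> (forall x y, d x y = 0 -> x = y) ->
  (forall x y, d x y = d y x) -> (forall y x z, d x z <= d x y + d y z) ->
  (forall x y, V (d x y)) ->
  exists f : T -> U, forall x y, mdist (f x) (f y) = d x y.
Proof.
move=> d0 dpos dsym dtri dV.
have [M [h [hT hd]]] := metric_of_distance d0 dpos dsym dtri.
have [_ _ Uage] := U_urysohn.
have [_ [_ [_ [g [gd _]]]]] : in_age U M.
  apply/Uage.
  split; first by rewrite -hT; apply: finite_image; exact: finite_finset.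
  move=> _ [x [y ->]].
  have [x' _ <-] : range h x by rewrite hT.
  have [y' _ <-] : range h y by rewrite hT.
  by rewrite hd.
by exists (g \o h) => x y /=; rewrite gd.
Qed.

Lemma urysohn_spectrum : spectrum U `<=` V.
Proof.
move=> _ [x [y ->]].
pose T := seq_sub [:: x; y].
have [||||M [h [hT hd]]] :=
  @metric_of_distance R T (fun a b => mdist (val a) (val b)).
- by move=> a; exact: mdistxx.
- by move=> a b /mdist_positivity/val_inj.
- by move=> a b; exact: metric_sym.
- by move=> b a c; exact: metric_triangle.
have [_ _ Uage] := U_urysohn.
have [_ MV] : finite_metric_spectrum_in V M.
  apply/Uage.
  split; first by rewrite -hT; apply: finite_image; exact: finite_finset.
  have pre (m : M) : exists t, h t = m.
    by have [t _ <-] : range h m by [rewrite hT]; exists t.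
  have [k kK] := choice pre.
  exists (range (val \o k)); split=> //; exists (val \o k); split=> // a b _ _.
  by rewrite /= -hd !kK.
apply: MV.
have xT : x \in [:: x; y] by rewrite inE eqxx.
have yT : y \in [:: x; y] by rewrite !inE eqxx orbT.
by exists (h (SeqSub xT)), (h (SeqSub yT)); rewrite hd.
Qed.

(** The finite space made of the points of [c] and one more point at the
    prescribed distances embeds into [U] by the age condition; homogeneity then
    moves the embedded copies of the points of [c] back onto these points, and
    the image of the additional point realizes [c]. *)
Lemma urysohn_saturated : V 0 -> saturated V [set: U].
Proof.
move=> V0 c ck _.
have [[z [zc z0]]|nz] := pselect (exists z, z \in c /\ z.2 = 0).
  by exists z.1; split=> //; exact: katetov_zero ck zc z0.
(* [None] is the additional point. Two pairs of [c] at distance zero are equal,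
   so the points of the auxiliary space can be the pairs themselves. *)
pose T := option (seq_sub c).
pose d (s t : T) : R := match s, t with
  | Some z, Some w => mdist (val z).1 (val w).1
  | Some z, None | None, Some z => (val z).2
  | None, None => 0
  end.
have [|||||f fd] := @finite_distance_embeds T d.
- by case=> [z|] //=; rewrite mdistxx.
- have nz' (z : seq_sub c) : (val z).2 <> 0.
    by move=> z0; apply: nz; exists (val z); split=> //; exact: valP.
  move=> [z|] [w|] //=; [|by move/nz'|by move/nz'].
  move=> /[dup] zw0 /mdist_positivity zw; congr Some; apply: val_inj.
  have := ck.2 _ _ (valP z) (valP w); have := ck.2 _ _ (valP w) (valP z).
  rewrite (metric_sym (val w).1) zw0.
  move=> wz zw2; have e : (val z).2 = (val w).2 by lra.
  by rewrite [val z]surjective_pairing [RHS]surjective_pairing; congr pair.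
- by move=> [z|] [w|] //=; rewrite metric_sym.
- move=> [w|] [z|] [t|] /=; rewrite ?addr0 ?add0r//.
  + exact: metric_triangle.
  + by have := ck.2 _ _ (valP z) (valP w); lra.
  + by have := ck.2 _ _ (valP t) (valP w); rewrite (metric_sym (val w).1); lra.
  + by have := ck.2 _ _ (valP w) (valP w); rewrite mdistxx; lra.
  + by have := ck.2 _ _ (valP z) (valP t); lra.
- move=> [z|] [w|] //=; [|exact: ck.1 (valP _)..].
  by apply: urysohn_spectrum; exists (val z).1, (val w).1.
pose A := range (f \o Some).
pose B := range (fun z : seq_sub c => (val z).1).
(* [g] sends the copy in [U] of each point of [c] to that point. *)
have gex u : exists v, forall z, u = f (Some z) -> v = (val z).1.
  have [[z ->]|nu] := pselect (exists z, u = f (Some z)).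
    exists (val z).1 => w /(congr1 (mdist (f (Some z)))).
    by rewrite mdistxx fd => /esym/mdist_positivity.
  by exists u => z uz; case: nu; exists z.
have [g gP] := choice gex.
have gE z : g (f (Some z)) = (val z).1 by exact: gP.
have [_ hom _] := U_urysohn.
have [|||h [[hd _] hg]] := hom A B g.
- by apply: finite_image; exact: finite_finset.
- by apply: finite_image; exact: finite_finset.
- split=> [_ _ [z _ <-] [w _ <-]|]; first by rewrite /= !gE fd.
  by rewrite /A image_comp; apply: eq_imagel => z _; exact: gE.
exists (h (f None)); split=> // z zc.
rewrite -[z.1](gE (SeqSub zc)) -hg; last by exists (SeqSub zc).
by rewrite hd// fd.
Qed.

End UrysohnSpaces.

Theorem theorem4p11 (R : realType) (V : set R)
    (V_countable : countable V)
    (V_ge0 : forall v : R, V v -> 0 <= v)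
    (V_0 : V 0)
    (V_four_values : four_values V)
    (V_accumulation : limit_point V 0)
    (U : metricType R) (U_urysohn : is_urysohn V U)
    (A : set U) (A_sub_scattered : sub_scattered V A) :
  isometric (~` A) [set: U].
Proof.
have sU := urysohn_saturated U_urysohn V_0.
apply: saturated_isometric (saturated_setC_sub_scattered sU A_sub_scattered) sU.
  exact: urysohn_spectrum.
by have [] := U_urysohn.
Qed.
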